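(* Let $\Lambda$ be a finite dimensional algebra over a field, let $0\to A\to B\to C\to0$ be a short exact sequence in $\mathrm{mod}\,\Lambda$, let $k>1$ be an integer and $n$ a nonnegative integer. If $k\text{-}\operatorname{dell}A\le n-1$ and $(k-1)\text{-}\operatorname{dell}B\le n$, then $(k-1)\text{-}\operatorname{edell}C\le n$.
   Context: $\mathrm{mod}\,\Lambda$ is the category of finitely generated right $\Lambda$-modules. $\mathbb N$ is the set of nonnegative integers; the infimum of the empty set is $+\infty$. $\Omega M$ is the kernel of a projective cover of $M$, $\Omega^0M=M$, $\Omega^{n+1}M=\Omega(\Omega^nM)$. ''$U$ is a direct summand of $V$ up to projective summands'' means that $U$ is isomorphic to a direct summand of $V\oplus P$ for some projective $P$. For an integer $k\ge1$: $k\text{-}\operatorname{dell}M$ is the infimum of all $n\in\mathbb N$ such that $\Omega^nM$ is a direct summand of $\Omega^{n+k}N$ up to projective summands for some $N\in\mathrm{mod}\,\Lambda$; and $k\text{-}\operatorname{edell}M$ is the infimum of all $n\in\mathbb N$ such that for every integer $k'\ge1$ and every right $\Lambda$-module $X$ of injective dimension $\mathrm{id}\,X=n+k-1+k'$ one has $\mathrm{Ext}_\Lambda^{n+k'}(M,X)=0$. *)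

(* Defs.v *)
From HB Require Import structures.
From mathcomp Require Import all_boot all_order all_algebra all_field.
From mathcomp Require Import boolp constructive_ereal.

Set Implicit Arguments.
Unset Strict Implicit.
Unset Printing Implicit Defensive.

Import Order.TTheory GRing.Theory Num.Theory.
Local Open Scope ring_scope.

(* Right modules over an algebra L are the left modules over the converse ring
   L^c: for a : L^c and x in the module, a *: x is the right action x . a.
   All notions below are stated for left modules over a ring R and are used
   with R := L^c. *)

Definition surj (U V : Type) (f : U -> V) : Prop := forall y, exists x, f x = y.

Definition exact_at (R : nzRingType) (U V W : lmodType R)
    (f : {linear U -> V}) (g : {linear V -> W}) : Prop :=
  forall y : V, g y = 0 <-> exists x : U, f x = y.

Definition short_exact (R : nzRingType) (U V W : lmodType R)
    (f : {linear U -> V}) (g : {linear V -> W}) : Prop :=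
  [/\ injective f, exact_at f g & surj g].

Definition fin_gen (R : nzRingType) (M : lmodType R) : Prop :=
  exists (m : nat) (e : 'I_m -> M),
    forall x : M, exists c : 'I_m -> R, x = \sum_(i < m) c i *: e i.

Definition projective (R : nzRingType) (P : lmodType R) : Prop :=
  forall (U V : lmodType R) (p : {linear U -> V}) (f : {linear P -> V}),
    surj p -> exists g : {linear P -> U}, forall x, p (g x) = f x.

Definition injective_module (R : nzRingType) (I : lmodType R) : Prop :=
  forall (U V : lmodType R) (i : {linear U -> V}) (f : {linear U -> I}),
    injective i -> exists g : {linear V -> I}, forall x, g (i x) = f x.

Definition superfluous_kernel (R : nzRingType) (P M : lmodType R)
    (p : {linear P -> M}) : Prop :=
  forall S : {pred P}, submod_closed S ->
    (forall x, exists s t : P, [/\ s \in S, p t = 0 & x = s + t]) ->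
    forall x, x \in S.

Definition projective_cover (R : nzRingType) (P M : lmodType R)
    (p : {linear P -> M}) : Prop :=
  [/\ projective P, surj p & superfluous_kernel p].

Definition isomorphic (R : nzRingType) (U V : lmodType R) : Prop :=
  exists phi : {linear U -> V}, bijective phi.

(* Syzygies are only defined up to isomorphism, so Omega^n is a relation:
   [syzygy n M K] says that K is (a representative of) Omega^n M. *)
Fixpoint syzygy (R : nzRingType) (n : nat) (M K : lmodType R) : Prop :=
  if n is m.+1 then
    exists (K' P : lmodType R) (i : {linear K -> P}) (p : {linear P -> K'}),
      [/\ syzygy m M K', projective_cover p, injective i & exact_at i p]
  else isomorphic M K.

Definition summand_up_to_projective (R : nzRingType) (U V : lmodType R) : Prop :=
  exists P U' : lmodType R,
    projective P /\ isomorphic (U * U')%type (V * P)%type.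

(* Infimum of a set of natural numbers in the extended integers; the infimum
   of the empty set is +oo. *)
Definition nat_inf (S : nat -> Prop) : \bar int :=
  if pselect (exists n, `[< S n >]) is left h then (ex_minn h)%:Z%:E
  else +oo%E.

Definition dell (R : nzRingType) (k : nat) (M : lmodType R) : \bar int :=
  nat_inf (fun n => exists N K L : lmodType R,
    [/\ fin_gen N, syzygy n M K, syzygy (n + k) N L
      & summand_up_to_projective K L]).

Record projective_resolution (R : nzRingType) (M : lmodType R) := ProjRes {
  pr_obj : nat -> lmodType R;
  pr_diff : forall i, {linear pr_obj i.+1 -> pr_obj i};
  pr_aug : {linear pr_obj 0 -> M};
  pr_projective : forall i, projective (pr_obj i);
  pr_aug_surj : surj pr_aug;
  pr_aug_exact : exact_at (pr_diff 0) pr_aug;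
  pr_exact : forall i, exact_at (pr_diff i.+1) (pr_diff i) }.

Definition cocycle (R : nzRingType) (M X : lmodType R)
    (P : projective_resolution M) (i : nat) (f : {linear pr_obj P i -> X}) :
    Prop :=
  forall x, f (pr_diff P i x) = 0.

Definition coboundary (R : nzRingType) (M X : lmodType R)
    (P : projective_resolution M) (i : nat) :
    {linear pr_obj P i -> X} -> Prop :=
  match i with
  | 0 => fun f => forall x, f x = 0
  | j.+1 => fun f =>
      exists g : {linear pr_obj P j -> X}, forall x, f x = g (pr_diff P j x)
  end.

(* Ext^i(M, X) = 0, where Ext^i(M, X) is the i-th cohomology of Hom(P, X) for
   a projective resolution P of M; it does not depend on the choice of P. *)
Definition Ext_zero (R : nzRingType) (i : nat) (M X : lmodType R) : Prop :=
  forall (P : projective_resolution M) (f : {linear pr_obj P i -> X}),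
    cocycle f -> coboundary f.

Record injective_resolution (R : nzRingType) (X : lmodType R) := InjRes {
  ir_obj : nat -> lmodType R;
  ir_diff : forall i, {linear ir_obj i -> ir_obj i.+1};
  ir_aug : {linear X -> ir_obj 0};
  ir_injective : forall i, injective_module (ir_obj i);
  ir_aug_inj : injective ir_aug;
  ir_aug_exact : exact_at ir_aug (ir_diff 0);
  ir_exact : forall i, exact_at (ir_diff i) (ir_diff i.+1) }.

(* The zero module gets injective dimension 0. *)
Definition injdim (R : nzRingType) (X : lmodType R) : \bar int :=
  nat_inf (fun d => exists I : injective_resolution X,
    forall i, (d < i)%N -> forall x : ir_obj I i, x = 0).

(* X ranges over all modules, not only the finitely generated ones. *)
Definition edell (R : nzRingType) (k : nat) (M : lmodType R) : \bar int :=
  nat_inf (fun n => forall (k' : nat) (X : lmodType R), (1 <= k')%N ->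
    injdim X = (n%:Z + k%:Z - 1 + k'%:Z)%:E -> Ext_zero (n + k') M X).

(* Main.v *)
Require Import Defs.
From HB Require Import structures.
From mathcomp Require Import all_boot all_order all_algebra all_field.
From mathcomp Require Import boolp constructive_ereal.
From mathcomp Require Import zify.

Set Implicit Arguments.
Unset Strict Implicit.
Unset Printing Implicit Defensive.

Import Order.TTheory GRing.Theory Num.Theory.
Local Open Scope ring_scope.

(* By dimension shifting along the syzygies, [Ext^(n-1+k')(A, X)] and
   [Ext^(n+k')(B, X)] are controlled by Ext groups in degrees [n-1+k+k'] out of
   the modules given by the dell hypotheses, and these vanish because they lie
   above [id X = n+k-2+k'].  The long exact sequence of
   [0 -> A -> B -> C -> 0] then kills [Ext^(n+k')(C, X)].  Ext is computed from
   a finite injective resolution of [X], and only at the end compared with the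
   computation from projective resolutions. *)

Lemma nat_inf_leP (S : nat -> Prop) (z : int) :
  (nat_inf S <= z%:E)%E <-> exists2 m, S m & m%:Z <= z.
Proof.
rewrite /nat_inf; case: pselect => [h|noS].
  case: ex_minnP => m /asboolP Sm minm; rewrite lee_fin; split.
    by move=> mz; exists m.
  case=> m' /asboolP Sm' m'z; apply: le_trans m'z.
  by rewrite lez_nat; apply: minm.
split=> [|[m Sm _]]; first by rewrite leye_eq.
by case: noS; exists m; apply/asboolP.
Qed.

Lemma linear_of_fun (R : nzRingType) (U V : lmodType R) (h : U -> V) :
  linear h -> exists g : {linear U -> V}, g =1 h.
Proof.
move=> lin_h.
pose b := GRing.isLinear.Build R U V *:%R h lin_h.
pose g : {linear U -> V} := HB.pack h b.
by exists g.
Qed.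

Lemma linear_factor_surj (R : nzRingType) (U V W : lmodType R)
    (p : {linear U -> V}) (h : {linear U -> W}) :
  surj p -> (forall x, p x = 0 -> h x = 0) ->
  exists t : {linear V -> W}, forall x, t (p x) = h x.
Proof.
move=> /choice [s ps] ker0.
have hE x y : p x = p y -> h x = h y.
  move=> pxy; apply/eqP; rewrite -subr_eq0 -linearB; apply/eqP/ker0.
  by rewrite linearB pxy subrr.
have [|t tE] := @linear_of_fun R V W (h \o s).
  by move=> a x y /=; rewrite -linearP; apply: hE; rewrite linearP !ps.
by exists t => x; rewrite tE /=; apply: hE; rewrite ps.
Qed.

Lemma linear_factor_inj (R : nzRingType) (U V W : lmodType R)
    (i : {linear U -> V}) (h : {linear W -> V}) :
  injective i -> (forall x, exists y, i y = h x) ->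
  exists t : {linear W -> U}, forall x, i (t x) = h x.
Proof.
move=> inj_i /choice [s is_]; have [|t tE] := @linear_of_fun R W U s.
  by move=> a x y; apply: inj_i; rewrite linearP !is_ linearP.
by exists t => x; rewrite tE.
Qed.

Definition kernel_pred (R : nzRingType) (U V : lmodType R)
  (p : {linear U -> V}) : {pred U} := fun x => p x == 0.

Lemma kernel_submod_closed (R : nzRingType) (U V : lmodType R)
  (p : {linear U -> V}) : submod_closed (kernel_pred p).
Proof.
split=> [|a x y]; rewrite !unfold_in ?linear0 //.
by move=> /eqP px /eqP py; rewrite linearP px py scaler0 addr0.
Qed.

HB.instance Definition _ (R : nzRingType) (U V : lmodType R)
    (p : {linear U -> V}) :=
  GRing.isSubmodClosed.Build R U (kernel_pred p) (kernel_submod_closed p).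

Record kernel (R : nzRingType) (U V : lmodType R) (p : {linear U -> V}) :=
  Kernel { kernel_val :> U; _ : kernel_val \in kernel_pred p }.

HB.instance Definition _ (R : nzRingType) (U V : lmodType R)
  (p : {linear U -> V}) := [isSub for @kernel_val R U V p].
HB.instance Definition _ (R : nzRingType) (U V : lmodType R)
  (p : {linear U -> V}) := [Choice of kernel p by <:].
HB.instance Definition _ (R : nzRingType) (U V : lmodType R)
  (p : {linear U -> V}) := [SubChoice_isSubLmodule of kernel p by <:].

Lemma exists_kernel (R : nzRingType) (U V : lmodType R) (p : {linear U -> V}) :
  exists (K : lmodType R) (i : {linear K -> U}), injective i /\ exact_at i p.
Proof.
exists (kernel p), (val : {linear kernel p -> U}); split; first exact: val_inj.
move=> y; split=> [/eqP py|[x <-]]; first by exists (Kernel py).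
by apply/eqP; apply: (valP x).
Qed.

(* [Ext^(i+1)(M, X) = 0], computed from an injective resolution of [X]. *)
Definition ext_vanish (R : nzRingType) (X : lmodType R)
    (I : injective_resolution X) (i : nat) (M : lmodType R) : Prop :=
  forall h : {linear M -> ir_obj I i.+1},
    (forall x, ir_diff I i.+1 (h x) = 0) ->
    exists g : {linear M -> ir_obj I i}, forall x, ir_diff I i (g x) = h x.

Lemma ir_diffK (R : nzRingType) (X : lmodType R) (I : injective_resolution X)
  i (x : ir_obj I i) : ir_diff I i.+1 (ir_diff I i x) = 0.
Proof. by apply/(@ir_exact _ _ I i); exists x. Qed.

Lemma exact_comp0 (R : nzRingType) (U V W : lmodType R)
    (f : {linear U -> V}) (g : {linear V -> W}) x :
  exact_at f g -> g (f x) = 0.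
Proof. by move=> fg; apply/fg; exists x. Qed.

Lemma ext_vanish_projective (R : nzRingType) (X : lmodType R)
    (I : injective_resolution X) i (P : lmodType R) :
  projective P -> ext_vanish I i P.
Proof.
move=> projP h dh0; have [K [j [inj_j ex_j]]] := exists_kernel (ir_diff I i.+1).
have [|h' h'E] := linear_factor_inj (h := h) inj_j.
  by move=> x; apply/ex_j.
have [|d dE] := linear_factor_inj (h := ir_diff I i) inj_j.
  by move=> x; apply/ex_j; apply: ir_diffK.
have [|g gE] := projP _ _ d h'.
  move=> y; have /(@ir_exact _ _ I i)[x xE] : ir_diff I i.+1 (j y) = 0.
    exact: exact_comp0.
  by exists x; apply: inj_j; rewrite dE.
by exists g => x; rewrite -dE gE h'E.
Qed.

Lemma ext_vanish_right (R : nzRingType) (X : lmodType R)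
    (I : injective_resolution X) i (A B C : lmodType R)
    (f : {linear A -> B}) (g : {linear B -> C}) :
  short_exact f g -> ext_vanish I i A -> ext_vanish I i.+1 B ->
  ext_vanish I i.+1 C.
Proof.
move=> [inj_f fg surj_g] EA EB h dh0.
have [|u uE] := EB (h \o g : {linear _ -> _}); first by move=> x; apply: dh0.
have [|v vE] := EA (u \o f : {linear _ -> _}).
  by move=> x; rewrite /= uE /= (exact_comp0 _ fg) linear0.
have [w wE] := @ir_injective _ _ I i _ _ _ v inj_f.
have [|t tE] := linear_factor_surj (h := u \- (ir_diff I i \o w)) surj_g.
  by move=> _ /fg[a <-] /=; rewrite wE vE /= subrr.
exists t => c; have [b <-] := surj_g c.
by rewrite tE /= linearB /= ir_diffK subr0 uE.
Qed.

Lemma ext_vanish_left (R : nzRingType) (X : lmodType R)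
    (I : injective_resolution X) i (A B C : lmodType R)
    (f : {linear A -> B}) (g : {linear B -> C}) :
  short_exact f g -> ext_vanish I i B -> ext_vanish I i.+1 C ->
  ext_vanish I i A.
Proof.
move=> [inj_f fg surj_g] EB EC h dh0.
have [w wE] := @ir_injective _ _ I i.+1 _ _ _ h inj_f.
have [|t tE] := linear_factor_surj (h := ir_diff I i.+1 \o w) surj_g.
  by move=> _ /fg[a <-] /=; rewrite wE dh0.
have [|s sE] := EC t.
  by move=> c; have [b <-] := surj_g c; rewrite tE /= ir_diffK.
have [|r rE] := EB (w \- (s \o g) : {linear _ -> _}).
  by move=> b /=; rewrite linearB /= sE tE subrr.
exists (r \o f : {linear _ -> _}) => a /=.
by rewrite rE /= wE (exact_comp0 _ fg) linear0 subr0.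
Qed.

Lemma ext_vanish_retract (R : nzRingType) (X : lmodType R)
    (I : injective_resolution X) i (U V : lmodType R)
    (s : {linear U -> V}) (r : {linear V -> U}) :
  cancel s r -> ext_vanish I i V -> ext_vanish I i U.
Proof.
move=> sK EV h dh0; have [|g gE] := EV (h \o r : {linear _ -> _}).
  by move=> x; apply: dh0.
by exists (g \o s : {linear _ -> _}) => x /=; rewrite gE /= sK.
Qed.

Lemma isomorphic_inverse (R : nzRingType) (U V : lmodType R) :
  isomorphic U V -> exists (s : {linear U -> V}) (r : {linear V -> U}),
    cancel s r /\ cancel r s.
Proof.
move=> [s [r sK rK]]; have [|r' r'E] := @linear_of_fun R V U r.
  by move=> a x y; apply: (can_inj sK); rewrite linearP !rK.
by exists s, r'; split=> x; rewrite r'E ?sK ?rK.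
Qed.

Lemma ext_vanish_prod (R : nzRingType) (X : lmodType R)
    (I : injective_resolution X) i (U V : lmodType R) :
  ext_vanish I i U -> ext_vanish I i V -> ext_vanish I i (U * V)%type.
Proof.
move=> EU EV h dh0.
have [i1 i1E] : exists i1 : {linear U -> (U * V)%type}, i1 =1 fun x => (x, 0).
  by apply: linear_of_fun => a x y; congr pair; rewrite /= scaler0 addr0.
have [i2 i2E] : exists i2 : {linear V -> (U * V)%type}, i2 =1 pair 0.
  by apply: linear_of_fun => a x y; congr pair; rewrite /= scaler0 addr0.
have [|g1 g1E] := EU (h \o i1 : {linear _ -> _}); first by move=> x; apply: dh0.
have [|g2 g2E] := EV (h \o i2 : {linear _ -> _}); first by move=> x; apply: dh0.
exists ((g1 \o fst) \+ (g2 \o snd) : {linear _ -> _}) => -[x y] /=.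
rewrite linearD /= g1E g2E /= -linearD i1E i2E.
by congr (h _); congr pair; rewrite /= ?addr0 ?add0r.
Qed.

Lemma ext_vanish_summand (R : nzRingType) (X : lmodType R)
    (I : injective_resolution X) i (U V : lmodType R) :
  summand_up_to_projective U V -> ext_vanish I i V -> ext_vanish I i U.
Proof.
move=> [P [U' [projP /isomorphic_inverse[s [r [sK _]]]]]] EV.
have [i1 i1E] : exists i1 : {linear U -> (U * U')%type}, i1 =1 fun x => (x, 0).
  by apply: linear_of_fun => a x y; congr pair; rewrite /= scaler0 addr0.
apply: (@ext_vanish_retract _ _ _ _ _ _
  (s \o i1 : {linear _ -> _}) (fst \o r : {linear _ -> _})).
  by move=> x; rewrite /= sK i1E.
by apply: ext_vanish_prod => //; apply: ext_vanish_projective.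
Qed.

Lemma ext_vanish_syzygy (R : nzRingType) (X : lmodType R)
    (I : injective_resolution X) m (M K : lmodType R) :
  syzygy m M K -> forall i, ext_vanish I i K <-> ext_vanish I (i + m) M.
Proof.
elim: m K => [|m IH] K /=.
  move=> /isomorphic_inverse[s [r [sK rK]]] i; rewrite addn0.
  by split; apply: ext_vanish_retract; eassumption.
move=> [K' [P [j [p [syzK' [projP surj_p _] inj_j ex_p]]]]] i.
have ex_jp := And3 inj_j ex_p surj_p.
have EP i' : ext_vanish I i' P by apply: ext_vanish_projective.
rewrite addnS -addSn; split=> [EK|/(IH _ syzK') EK'].
  by apply/(IH _ syzK'); apply: (ext_vanish_right ex_jp).
exact: (ext_vanish_left ex_jp).
Qed.

Lemma ext_vanish_dell (R : nzRingType) (X : lmodType R)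
    (I : injective_resolution X) (d k n i : nat) (M : lmodType R) :
  (forall i, (d < i)%N -> forall x : ir_obj I i, x = 0) ->
  (dell k M <= n%:Z%:E)%E -> (d <= i + n + k)%N -> ext_vanish I (i + n) M.
Proof.
move=> I0 /nat_inf_leP[m [N [K [L [_ syzK syzL KL]]]]]; rewrite lez_nat => mn dn.
rewrite -(subnK mn) addnA -(ext_vanish_syzygy I syzK).
apply: ext_vanish_summand KL _; apply/(ext_vanish_syzygy I syzL) => h _.
have h0 x : h x = 0.
  by apply: I0; rewrite ltnS !addnA -(addnA i) subnK.
by exists (\0 : {linear _ -> _}) => x; rewrite h0 linear0.
Qed.

Lemma projective_resolution_kernel (R : nzRingType) (X : lmodType R)
    (I : injective_resolution X) (M : lmodType R)
    (P : projective_resolution M) j i :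
  ext_vanish I (i + j) M ->
  exists (Z : lmodType R) (p : {linear pr_obj P j -> Z}),
    [/\ surj p, exact_at (pr_diff P j) p & ext_vanish I i Z].
Proof.
elim: j i => [|j IH] i.
  rewrite addn0 => EM; exists M, (pr_aug P); split=> //.
    exact: pr_aug_surj.
  exact: pr_aug_exact.
rewrite addnS -addSn => /IH[Z [p [surj_p ex_p EZ]]].
have [K [j0 [inj_j0 ex_j0]]] := exists_kernel p.
have [|q qE] := linear_factor_inj (h := pr_diff P j) inj_j0.
  by move=> x; apply/ex_j0; apply: exact_comp0.
exists K, q; split.
- move=> y; have /ex_p[x xE] : p (j0 y) = 0 by apply: exact_comp0.
  by exists x; apply: inj_j0; rewrite qE.
- move=> y; rewrite -(@pr_exact _ _ P j y) -qE.
  by split=> [->|]; rewrite ?linear0 // -[RHS](linear0 j0) => /inj_j0.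
- apply: (ext_vanish_left (And3 inj_j0 ex_j0 surj_p)) => //.
  by apply: ext_vanish_projective; apply: pr_projective.
Qed.

Lemma ext_vanish_extend (R : nzRingType) (X : lmodType R)
    (I : injective_resolution X) (A B C : lmodType R)
    (f : {linear A -> B}) (g : {linear B -> C}) (h : {linear A -> X}) :
  short_exact f g -> ext_vanish I 0 C ->
  exists h' : {linear B -> X}, forall x, h' (f x) = h x.
Proof.
move=> [inj_f fg surj_g] EC.
have [w wE] := @ir_injective _ _ I 0 _ _ _ (ir_aug I \o h : {linear _ -> _}) inj_f.
have [|t tE] := linear_factor_surj (h := ir_diff I 0 \o w) surj_g.
  by move=> _ /fg[a <-] /=; rewrite wE; apply/(@ir_aug_exact _ _ I); exists (h a).
have [|s sE] := EC t.
  by move=> c; have [b <-] := surj_g c; rewrite tE /= ir_diffK.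
have [|h' h'E] :=
    linear_factor_inj (h := w \- (s \o g)) (@ir_aug_inj _ _ I).
  by move=> b; apply/(@ir_aug_exact _ _ I); rewrite /= linearB /= sE tE subrr.
exists h' => a; apply: (@ir_aug_inj _ _ I).
by rewrite h'E /= wE (exact_comp0 _ fg) linear0 subr0.
Qed.

Lemma ext_vanish_Ext_zero (R : nzRingType) (X : lmodType R)
    (I : injective_resolution X) i (M : lmodType R) :
  ext_vanish I i M -> Ext_zero i.+1 M X.
Proof.
move=> EM P f cf; have [Z [p [surj_p ex_p EZ]]] :=
  @projective_resolution_kernel _ _ I _ P i 0 EM.
have [K [j [inj_j ex_j]]] := exists_kernel p.
have [|q qE] := linear_factor_inj (h := pr_diff P i) inj_j.
  by move=> x; apply/ex_j; apply: exact_comp0.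
have surj_q : surj q.
  move=> y; have /ex_p[x xE] : p (j y) = 0 by apply: exact_comp0.
  by exists x; apply: inj_j; rewrite qE.
have [|f' f'E] := linear_factor_surj (h := f) surj_q.
  by move=> x qx0; have /(@pr_exact _ _ P i)[y <-] : pr_diff P i x = 0;
    rewrite ?cf // -qE qx0 linear0.
have [g gE] := ext_vanish_extend f' (And3 inj_j ex_j surj_p) EZ.
by exists g => x; rewrite -qE gE f'E.
Qed.

Theorem lemma2p28 (F : fieldType) (Lambda : falgType F)
    (A B C : lmodType Lambda^c)
    (fgA : fin_gen A) (fgB : fin_gen B) (fgC : fin_gen C)
    (f : {linear A -> B}) (g : {linear B -> C}) (fg_exact : short_exact f g)
    (k n : nat) (k_gt1 : (1 < k)%N)
    (dellA : (dell k A <= (n%:Z - 1)%:E)%E)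
    (dellB : (dell (k - 1) B <= n%:Z%:E)%E) :
  (edell (k - 1) C <= n%:Z%:E)%E.
Proof.
apply/nat_inf_leP; exists n => // -[//|k'] X _ injdimX.
have [d [I I0]] : exists2 d : nat,
    exists I : injective_resolution X,
      forall i, (d < i)%N -> forall x : ir_obj I i, x = 0 &
    d%:Z <= n%:Z + (k - 1)%N%:Z - 1 + k'.+1%:Z.
  by apply/nat_inf_leP; rewrite -injdimX.
case: n dellA dellB {injdimX} => [|n] dellA dellB dE.
  by have /nat_inf_leP[m _] := dellA; rewrite -ltzD1 subrK.
have {dE} dE : (d <= k' + n.+1 + (k - 1))%N.
  by rewrite -lez_nat (le_trans dE) // !PoszD; lia.
rewrite addnS; apply: (ext_vanish_Ext_zero (I := I)); rewrite addnC addnS.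
apply: (ext_vanish_right fg_exact); last first.
  by rewrite -addnS; apply: (ext_vanish_dell (k := (k - 1)%N) I0).
apply: (ext_vanish_dell (k := k) I0); last lia.
by move: dellA; rewrite -addn1 PoszD addrK.
Qed.
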